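(* Let $(W,S)$ be a Coxeter system with root datum $(V,\Sigma,\Sigma^\vee)$ as in the context. Let $\chi\in V$ be dominant with stabilizer subgroup $\mathrm{stab}_W(\chi)=W_J$, where $J\subset S$. For any $w\in W^J$, the following equality holds in $Q(V)$: $$\sum \frac{m_k}{m_1\beta_1+m_2\beta_2+\cdots+m_k\beta_k}\cdot\ldots\cdot\frac{m_2}{m_1\beta_1+m_2\beta_2}\cdot\frac{m_1}{m_1\beta_1}=\prod_{\beta\in S(w)}\left(1+\frac1\beta\right),$$ where the sum is over all integers $k\ge 0$ and all directed paths $$x_k\overset{\beta_k}{\longrightarrow}x_{k-1}\overset{\beta_{k-1}}{\longrightarrow}\cdots\overset{\beta_1}{\longrightarrow}x_0=w\quad\text{in } W^J,$$ and $m_i:=(\chi,\gamma_i^\vee)$ for the unique $\gamma_i\in R^+$ such that $x_{i-1}W_J=x_is_{\gamma_i}W_J$ ($1\le i\le k$). (The path with $k=0$ contributes the empty product $1$.) Moreover (taking the lowest degree terms), $$\sum \frac{m_k}{m_1\beta_1+m_2\beta_2+\cdots+m_k\beta_k}\cdot\ldots\cdot\frac{m_1}{m_1\beta_1}=\prod_{\beta\in S(w)}\frac1\beta,$$ where the sum is now over all such directed paths of length exactly $k=\ell(w)$, with the same $m_i$.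
   Context: $(W,S)$ is a Coxeter system with $S=\{s_1,\dots,s_r\}$ finite, length function $\ell$ and Bruhat order $\le$. A root datum $(V,\Sigma,\Sigma^\vee)$ of $W$ consists of a finite-dimensional real vector space $V$ which is a representation of $W$, with $V^*=\mathrm{Hom}_{\mathbb R}(V,\mathbb R)$ and natural pairing $(\cdot,\cdot):V\times V^*\to\mathbb R$, together with linearly independent sets $\Sigma=\{\alpha_1,\dots,\alpha_r\}\subset V$ and $\Sigma^\vee=\{\alpha_1^\vee,\dots,\alpha_r^\vee\}\subset V^*$ such that $(\alpha_i,\alpha_i^\vee)=2$ and $s_i\lambda=\lambda-(\lambda,\alpha_i^\vee)\alpha_i$ for $\lambda\in V$. $W$ acts on $V^*$ by $s_i(y)=y-(\alpha_i,y)\alpha_i^\vee$. The roots are $R=\{w(\alpha_i)\mid w\in W,\ 1\le i\le r\}$; $R^+$ is the set of roots of the form $\sum_i c_i\alpha_i$ with all $c_i\ge 0$, and $R^-=-R^+$. For $w\in W$, $S(w):=R^+\cap wR^-$. It is part of the setting that $R=R^+\sqcup R^-$ and that for every reduced expression $w=s_{i_1}\cdots s_{i_\ell}$ one has $|S(w)|=\ell$ and $S(w)=\{\beta_1,\dots,\beta_\ell\}$ where $\beta_j=s_{i_1}\cdots s_{i_{j-1}}\alpha_{i_j}$. For a root $\gamma=w(\alpha_i)$, the dual root is $\gamma^\vee=w(\alpha_i^\vee)$. For $\beta\in R^+$, $s_\beta\in W$ is the reflection $s_\beta(x)=x-(x,\beta^\vee)\beta$. For $J\subset S$, $W_J$ is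 the subgroup generated by $J$, and $W^J$ is the set of minimal length representatives of the cosets in $W/W_J$, with the induced Bruhat order. An element $\chi\in V$ is dominant if $(\chi,\alpha_j^\vee)\ge 0$ for all $1\le j\le r$. $Q(V)$ is the fraction field of the symmetric algebra $S(V)$ over $\mathbb R$. For $x,y\in W^J$ and $\beta\in R^+$, write $x\overset{\beta}{\to}y$ if $yW_J=s_\beta xW_J$ and $x<y$. (Given $x<y$ in $W^J$, such a $\beta$ exists if and only if there is $\gamma\in R^+$ with $yW_J=xs_\gamma W_J$, and it is then unique.) *)

(* Defs.v *)
From HB Require Import structures.
From mathcomp Require Import all_boot all_order all_algebra.
From mathcomp Require Import mpoly.
From mathcomp Require Import boolp classical_sets functions cardinality fsbigop.
From mathcomp Require Import reals.

Set Implicit Arguments.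
Unset Strict Implicit.
Unset Printing Implicit Defensive.

Import Order.TTheory GRing.Theory Num.Theory.

Local Open Scope classical_set_scope.
Local Open Scope ring_scope.

(* The generators are indexed by 'I_r.  A Coxeter matrix entry equal to 0
   stands for infinity: the corresponding relation reads x ^+ 0 = 1. *)
Definition coxeter_relations (r : nat) (m : 'I_r -> 'I_r -> nat)
    (G : groupType) (f : 'I_r -> G) : Prop :=
  forall i j, ((f i * f j) ^+ m i j = 1)%g.

Definition word (r : nat) (G : groupType) (f : 'I_r -> G) (u : seq 'I_r) : G :=
  (\prod_(i <- u) f i)%g.

(* W is the group presented by the generators s_i and the Coxeter relations.
   As the s_i are involutions, words in the s_i (without inverses) suffice to
   express that they generate W. *)
Record coxeterSystem (W : groupType) (r : nat) := CoxeterSystem {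
  cox_gen : 'I_r -> W;
  cox_mat : 'I_r -> 'I_r -> nat;
  cox_mat_diag : forall i, cox_mat i i = 1%N;
  cox_mat_sym : forall i j, cox_mat i j = cox_mat j i;
  cox_mat_offdiag : forall i j, i != j -> cox_mat i j != 1%N;
  cox_gen_rel : coxeter_relations cox_mat cox_gen;
  cox_generates : forall w, exists u, word cox_gen u = w;
  cox_universal : forall (G : groupType) (f : 'I_r -> G),
    coxeter_relations cox_mat f ->
    exists phi : W -> G, {morph phi : x y / (x * y)%g} /\
                         forall i, phi (cox_gen i) = f i
}.

Section Coxeter.
Variables (W : groupType) (r : nat) (C : coxeterSystem W r).
Local Notation s := (cox_gen C).

Lemma has_word_size (w : W) :
  exists n, `[< exists u : seq 'I_r, size u = n /\ word s u = w >].
Proof.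
by have [u uw] := cox_generates C w; exists (size u); apply/asboolP; exists u.
Qed.

Definition cox_length (w : W) : nat := ex_minn (has_word_size w).

Definition reduced (u : seq 'I_r) : Prop := size u = cox_length (word s u).

Definition cox_reflections : set W :=
  [set t | exists v i, t = (v * s i * v^-1)%g].

Inductive bruhat_le (x : W) : W -> Prop :=
| bruhat_refl : bruhat_le x x
| bruhat_step y t : bruhat_le x y -> cox_reflections t ->
    (cox_length y < cox_length (t * y)%g)%N -> bruhat_le x (t * y)%g.

Definition bruhat_lt (x y : W) : Prop := bruhat_le x y /\ x <> y.

Inductive parabolic (J : {set 'I_r}) : W -> Prop :=
| parabolic_gen i : i \in J -> parabolic J (s i)
| parabolic1 : parabolic J 1%g
| parabolicM x y : parabolic J x -> parabolic J y -> parabolic J (x * y)%g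
| parabolicV x : parabolic J x -> parabolic J (x^-1)%g.

Definition same_coset (J : {set 'I_r}) (x y : W) : Prop :=
  exists2 u, parabolic J u & y = (x * u)%g.

Definition min_rep (J : {set 'I_r}) : set W :=
  [set w | forall y, same_coset J w y -> (cox_length w <= cox_length y)%N].

End Coxeter.

Record rootDatum (R : realType) (W : groupType) (r : nat)
    (C : coxeterSystem W r) (V : vectType R) := RootDatum {
  rep : W -> 'End(V);
  rep1 : rep 1%g = \1%VF;
  repM : forall x y : W, rep (x * y)%g = (rep x \o rep y)%VF;
  sroot : 'I_r -> V;
  scoroot : 'I_r -> 'Hom(V, R^o);
  sroot_free : free [seq sroot i | i : 'I_r];
  scoroot_free : free [seq scoroot i | i : 'I_r];
  sroot_scoroot : forall i, scoroot i (sroot i) = 2;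
  rep_gen : forall i v,
    rep (cox_gen C i) v = v - (scoroot i v : R) *: sroot i
}.

Section RootDatum.
Variables (R : realType) (W : groupType) (r : nat) (C : coxeterSystem W r).
Variables (V : vectType R) (D : rootDatum C V).
Local Notation s := (cox_gen C).

Definition pairing (v : V) (y : 'Hom(V, R^o)) : R := y v.

Definition dual_rep (w : W) (y : 'Hom(V, R^o)) : 'Hom(V, R^o) :=
  (y \o rep D w^-1%g)%VF.

Lemma dual_rep_gen i (y : 'Hom(V, R^o)) :
  dual_rep (s i) y = y - pairing (sroot D i) y *: scoroot D i.
Proof.
have sV : (s i)^-1%g = s i.
  have := cox_gen_rel C i i; rewrite cox_mat_diag expg1 => h.
  by apply: (mulgI (s i)); rewrite mulgV h.
apply/lfunP => v; rewrite /dual_rep sV comp_lfunE rep_gen linearB linearZ.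
by rewrite add_lfunE opp_lfunE scale_lfunE; congr (_ - _); exact: mulrC.
Qed.

Definition roots : set V := [set g | exists w i, g = rep D w (sroot D i)].

Definition posroots : set V :=
  [set g | roots g /\ exists2 c : 'I_r -> R,
     forall i, 0 <= c i & g = \sum_i c i *: sroot D i].

Definition negroots : set V := -%R @` posroots.

Definition inversions (w : W) : set V := posroots `&` rep D w @` negroots.

Definition roots_split : Prop :=
  roots = posroots `|` negroots /\ posroots `&` negroots = set0.

Definition inversions_of_reduced : Prop :=
  forall u : seq 'I_r, reduced C u ->
    (inversions (word s u) #= `I_(size u))%card /\
    inversions (word s u) =
      [set b | exists u1 i u2, u = u1 ++ i :: u2 /\
                               b = rep D (word s u1) (sroot D i)].

(* Under roots_split and inversions_of_reduced, the dual root and the reflection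
   of a root are unique, so the default values of xget play no role; the same
   holds for edge_root on the edges of a path when W_J is the stabilizer of a
   vector. *)
Definition coroot (g : V) : 'Hom(V, R^o) :=
  xget 0 [set y | exists w i, g = rep D w (sroot D i) /\
                              y = dual_rep w (scoroot D i)].

Definition root_refl (b : V) : W :=
  xget 1%g [set t | forall v, rep D t v = v - pairing v (coroot b) *: b].

Definition dominant (chi : V) : Prop :=
  forall j, 0 <= pairing chi (scoroot D j).

Definition stabilizer (chi : V) : set W := [set w | rep D w chi = chi].

Variable J : {set 'I_r}.

Definition edge (x : W) (b : V) (y : W) : Prop :=
  [/\ min_rep C J x, min_rep C J y, posroots b,
      same_coset C J (root_refl b * x)%g y & bruhat_lt C x y].

(* A path  x_k --b_k--> ... --b_1--> x_0 = w  is encoded by the sequence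
   [:: (b_1, x_1); ...; (b_k, x_k)], read backwards from its endpoint w. *)
Definition path_vertex (w : W) (p : seq (V * W)) (i : nat) : W :=
  nth 1%g (w :: [seq q.2 | q <- p]) i.

Definition path_root (p : seq (V * W)) (i : nat) : V :=
  nth 0 [seq q.1 | q <- p] i.-1.

Definition paths_to (w : W) : set (seq (V * W)) :=
  [set p | forall i, (1 <= i <= size p)%N ->
     edge (path_vertex w p i) (path_root p i) (path_vertex w p i.-1)].

Definition edge_root (x y : W) : V :=
  xget 0 [set g | posroots g /\ same_coset C J (x * root_refl g)%g y].

Definition path_mult (chi : V) (w : W) (p : seq (V * W)) (i : nat) : R :=
  pairing chi (coroot (edge_root (path_vertex w p i) (path_vertex w p i.-1))).

End RootDatum.

Section SymmetricAlgebra.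
Variables (R : realType) (V : vectType R).

(* The symmetric algebra of V, realized as the polynomial ring on a basis of V,
   with Sym_in the inclusion of V; it satisfies the universal property
   Sym_universal. *)
Local Notation Sym := {mpoly R[\dim {:V}]}.

Definition Sym_in (v : V) : Sym :=
  \sum_(i < \dim {:V}) coord (vbasis {:V}) i v *: 'X_i.

Lemma Sym_universal (A : comAlgType R) (f : {linear V -> A}) :
  exists phi : {lrmorphism Sym -> A}, (forall v, phi (Sym_in v) = f v) /\
    forall psi : {lrmorphism Sym -> A},
      (forall v, psi (Sym_in v) = f v) -> psi =1 phi.
Proof.
pose h (i : 'I_(\dim {:V})) := f (vbasis {:V})`_i.
pose phi0 : Sym -> A := mmap (in_alg A) h.
have [phi phiX] : exists phi : {lrmorphism Sym -> A}, forall i, phi 'X_i = h i.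
  have phi0D : zmod_morphism phi0 by exact: mmap_is_additive.
  have phi0M : monoid_morphism phi0.
    by case: (mmap_is_multiplicative h (in_alg A)).
  have phi0Z : scalable phi0 by move=> c p; rewrite /phi0 mmapZ mulr_algl.
  pose aM := GRing.isZmodMorphism.Build Sym A phi0 phi0D.
  pose mM := GRing.isMonoidMorphism.Build Sym A phi0 phi0M.
  pose zM := GRing.isScalable.Build R Sym A *:%R phi0 phi0Z.
  pose phi : {lrmorphism Sym -> A} := HB.pack phi0 aM mM zM.
  by exists phi => i; rewrite /phi /= /phi0 mmapX mmap1U.
exists phi; split=> [v|psi psiE p].
  rewrite /Sym_in linear_sum {2}(coord_vbasis (memvf v)) linear_sum.
  by apply: eq_bigr => i _; rewrite !linearZ; congr (_ *: _); exact: phiX.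
have psiX i : psi 'X_i = phi 'X_i.
  rewrite phiX /h -psiE; congr (psi _).
  rewrite /Sym_in (bigD1 i) //= coord_free ?(basis_free (vbasisP _)) // eqxx.
  rewrite scale1r big1 ?addr0 // => j ji.
  rewrite coord_free ?(basis_free (vbasisP _)) //.
  by rewrite eq_sym (negPf ji) scale0r.
rewrite [p]mpolyE !linear_sum; apply: eq_bigr => m _; rewrite !linearZ.
congr (_ *: _); rewrite mpolyXE_id !rmorph_prod; apply: eq_bigr => i _.
by rewrite !rmorphXn; congr (_ ^+ _); exact: psiX.
Qed.

Definition QSym := {fraction Sym}.
HB.instance Definition _ := GRing.Field.on QSym.

Definition QSym_in (v : V) : QSym := FracField.tofrac (Sym_in v).
Definition QSym_const (a : R) : QSym := FracField.tofrac (a%:A : Sym).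

End SymmetricAlgebra.

Section PathWeight.
Variables (R : realType) (W : groupType) (r : nat) (C : coxeterSystem W r).
Variables (V : vectType R) (D : rootDatum C V) (J : {set 'I_r}).

Definition path_weight (chi : V) (w : W) (p : seq (V * W)) : QSym V :=
  let m := path_mult D J chi w p in
  \prod_(1 <= i < (size p).+1)
    (QSym_const V (m i) /
     QSym_in (\sum_(1 <= j < i.+1) m j *: path_root p j)).

End PathWeight.

(* Main.v *)
Require Import Defs.
From HB Require Import structures.
From mathcomp Require Import all_boot all_order all_algebra.
From mathcomp Require Import finmap mpoly.
From mathcomp Require Import boolp classical_sets functions cardinality fsbigop.
From mathcomp Require Import reals.
From mathcomp Require Import ring.

(** The weights of the paths only see the orbit of [chi].  Write
    [(mu, b^)] for the value of the coroot of [b] at [mu].  An edge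
    [x --b--> y] moves [x chi] to [y chi = x chi - m b] with
    [m = (x chi, b^) = - (y chi, b^) > 0], and this [m] is the multiplicity
    attached to the edge; hence along a path ending in [w] the denominator
    [m_1 b_1 + ... + m_i b_i] telescopes to [x_i chi - w chi]
    ([path_telescope]).  Conversely the edges ending in a minimal
    representative [y] correspond to the positive roots [b] with
    [(y chi, b^) < 0] ([edgeP]).  So, with [nu = w chi] and
    [(D f)(mu) = \sum_(b > 0, (mu, b^) < 0) - (mu, b^) f(s_b mu)], the sum over
    the paths of length [k] is obtained by applying [k] times the operator
    [f |-> D (f / (_ - nu))] to the constant [1] and evaluating at [nu]
    ([path_enum]).

    For the other side, take a reduced word [i_1 ... i_l] of [w] and expand
    [(s_(i_1) + 1 / a_(i_1)) ... (s_(i_l) + 1 / a_(i_l))], [a_i] being the simple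
    roots, in the skew group ring of [W] over Q(V).  Acting on the base point
    [chi], the terms in which [k] letters have been replaced by scalars form a
    Q(V)-linear combination of points of the orbit; [deletion_sum] is the
    pairing [L_k] of this combination with a function [f] on the orbit.  As
    S(s_i w) is [a_i] together with [s_i] applied to S(w) whenever [s_i w] is
    longer than [w], [L_k 1] is the [k]-th elementary symmetric function of the
    [1 / b], [b] in S(w): summing over [k] gives [\prod (1 + 1 / b)], and the
    top term [k = l] is [\prod 1 / b].  Keeping track of [k] is what gives both
    identities at once.

    The two sides are linked by the relation
    [L_(k+1) (f * (_ - nu)) = L_k (D f)] ([deletion_sum_rec]), the analogue of
    the Chevalley formula.  It is proved one letter at a time, and reduces to
    the rule [(D f)(s_i mu) = (D (f \o s_i))(mu) + (mu, a_i^) f(mu)]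
    ([descent_sum_gen]), which only expresses that [s_i] permutes the positive
    roots other than [a_i].  When [w] is minimal in its coset, [L_(k+1)] puts no
    mass on the point [nu] ([deletion_sum_fiber]), so one may divide by
    [_ - nu], and by induction [L_k f] is the [k]-fold iterate above
    ([deletion_sum_iter]).

    To avoid an action of [W] on Q(V), scalars are read through a linear map
    [phi] from [V] to a field, on which [W] acts by precomposition. *)

Set Implicit Arguments.
Unset Strict Implicit.
Unset Printing Implicit Defensive.

Import Order.TTheory GRing.Theory Num.Theory.

Local Open Scope classical_set_scope.
Local Open Scope ring_scope.

(** * Words, length and the Bruhat order *)

Section Words.
Variables (W : groupType) (r : nat) (C : coxeterSystem W r).
Local Notation s := (cox_gen C).
Local Notation len := (cox_length C).

Lemma gen_sqr i : (s i * s i = 1)%g.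
Proof. by have := cox_gen_rel C i i; rewrite cox_mat_diag expg1. Qed.

Lemma gen_inv i : ((s i)^-1 = s i)%g.
Proof. by apply: (mulgI (s i)); rewrite mulgV gen_sqr. Qed.

Lemma word_nil : word s [::] = 1%g.
Proof. by rewrite /word big_nil. Qed.

Lemma word_cons i u : word s (i :: u) = (s i * word s u)%g.
Proof. by rewrite /word big_cons. Qed.

Lemma word_cat u v : word s (u ++ v) = (word s u * word s v)%g.
Proof. by rewrite /word big_cat. Qed.

Lemma length_word u : (len (word s u) <= size u)%N.
Proof.
rewrite /cox_length; case: ex_minnP => m _; apply.
by apply/asboolP; exists u.
Qed.

Lemma reduced_word w : exists2 u, reduced C u & word s u = w.
Proof.
rewrite /reduced /cox_length; case: (ex_minnP (has_word_size C w)) => m.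
move=> /asboolP[u [su uw]] mP; exists u => //; rewrite uw.
by case: ex_minnP => n /asboolP nP nmin; apply/eqP; rewrite eqn_leq su mP ?nmin //;
  apply/asboolP => //; exists u.
Qed.

Lemma length_genM i w : (len (s i * w)%g <= (len w).+1)%N.
Proof.
have [u ur uw] := reduced_word w.
by rewrite -uw -word_cons -ur (length_word (i :: u)).
Qed.

Lemma length_Mgen i w : (len (w * s i)%g <= (len w).+1)%N.
Proof.
have [u ur uw] := reduced_word w.
have := length_word (rcons u i); rewrite -cats1 word_cat word_cons word_nil mulg1.
by rewrite uw size_cat addn1 ur uw.
Qed.

Lemma reduced_rcons u i : reduced C (rcons u i) -> reduced C u.
Proof.
rewrite /reduced size_rcons -cats1 word_cat word_cons word_nil mulg1 => ru.
apply/eqP; rewrite eqn_leq length_word andbT -ltnS ru; exact: length_Mgen.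
Qed.

Lemma length_eq0 w : len w = 0%N -> w = 1%g.
Proof.
have [u ur uw] := reduced_word w; rewrite -uw -ur => /size0nil ->.
exact: word_nil.
Qed.

Lemma bruhat_length x y : bruhat_le C x y -> x = y \/ (len x < len y)%N.
Proof.
elim=> [|z t xz IH tr lt]; first by left.
by right; case: IH => [->//|/ltn_trans]; apply.
Qed.

End Words.

(** * The embedding of the scalars into Q(V) *)

Section QSymConst.
Variables (R : realType) (V : vectType R).

Lemma QSym_const_zmod : zmod_morphism (@QSym_const R V).
Proof. by move=> a b; rewrite /QSym_const scalerBl rmorphB. Qed.

Lemma QSym_const_monoid : monoid_morphism (@QSym_const R V).
Proof.
split; first by rewrite /QSym_const scale1r rmorph1.
by move=> a b; rewrite /QSym_const -rmorphM mulr_algl scalerA.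
Qed.

HB.instance Definition _ :=
  GRing.isZmodMorphism.Build R (QSym V) (@QSym_const R V) QSym_const_zmod.
HB.instance Definition _ :=
  GRing.isMonoidMorphism.Build R (QSym V) (@QSym_const R V) QSym_const_monoid.

End QSymConst.

(** * Roots, coroots and reflections *)

Section Roots.
Variables (R : realType) (W : groupType) (r : nat) (C : coxeterSystem W r).
Variables (V : vectType R) (D : rootDatum C V).
Hypotheses (Hroots : roots_split D) (Hinv : inversions_of_reduced D).
Local Notation s := (cox_gen C).
Local Notation len := (cox_length C).
Local Notation al := (sroot D).
Local Notation act := (rep D).
Local Notation Rp := (posroots D).

Lemma act1 v : act 1%g v = v.
Proof. by rewrite rep1 id_lfunE. Qed.

Lemma actM x y v : act (x * y)%g v = act x (act y v).
Proof. by rewrite repM comp_lfunE. Qed.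

Lemma actB x u v : act x (u - v) = act x u - act x v.
Proof. exact: linearB. Qed.

Lemma actD x u v : act x (u + v) = act x u + act x v.
Proof. exact: linearD. Qed.

Lemma actN x v : act x (- v) = - act x v.
Proof. exact: linearN. Qed.

Lemma actZ x a v : act x (a *: v) = a *: act x v.
Proof. exact: linearZ. Qed.

Lemma actK x v : act x^-1%g (act x v) = v.
Proof. by rewrite -actM mulVg act1. Qed.

Lemma actVK x v : act x (act x^-1%g v) = v.
Proof. by rewrite -actM mulgV act1. Qed.

Lemma act_inj x : injective (act x).
Proof. by move=> u v /(congr1 (act x^-1%g)); rewrite !actK. Qed.

Lemma act_genK i : involutive (act (s i)).
Proof. by move=> v; rewrite -actM gen_sqr act1. Qed.

Lemma subr_double (v : V) : v - (2 : R) *: v = - v.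
Proof. by rewrite scaler_nat mulr2n opprD addrA subrr add0r. Qed.

Lemma act_gen_sroot i : act (s i) (al i) = - al i.
Proof. by rewrite rep_gen sroot_scoroot subr_double. Qed.

Definition cone (v : V) : Prop :=
  exists2 c : 'I_r -> R, forall i, 0 <= c i & v = \sum_i c i *: al i.

Lemma sroot_indep (c : 'I_r -> R) : \sum_i c i *: al i = 0 -> forall i, c i = 0.
Proof.
have := sroot_free D; have <- : tval [tuple al i | i < r] = [seq al i | i : 'I_r].
  by [].
move/freeP => H cE; apply: H; rewrite -[RHS]cE; apply: eq_bigr => i _.
by congr (_ *: _); rewrite -tnth_nth tnth_mktuple.
Qed.

Lemma cone0 : cone 0.
Proof. by exists (fun=> 0) => //; rewrite big1 // => i _; rewrite scale0r. Qed.

Lemma coneD u v : cone u -> cone v -> cone (u + v).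
Proof.
move=> [c c0 ->] [d d0 ->]; exists (fun i => c i + d i) => [i|].
  by rewrite addr_ge0.
by rewrite -big_split; apply: eq_bigr => i _; rewrite scalerDl.
Qed.

Lemma coneZ a v : 0 <= a -> cone v -> cone (a *: v).
Proof.
move=> a0 [c c0 ->]; exists (fun i => a * c i) => [i|]; first exact: mulr_ge0.
by rewrite scaler_sumr; apply: eq_bigr => i _; rewrite scalerA.
Qed.

Lemma coneN v : cone v -> cone (- v) -> v = 0.
Proof.
move=> [c c0 ->] [d d0 dE]; have cd0 : forall i, c i + d i = 0.
  apply: sroot_indep; under eq_bigr do rewrite scalerDl.
  by rewrite big_split /= -dE subrr.
rewrite big1 // => i _; suff -> : c i = 0 by rewrite scale0r.
by apply/eqP; rewrite eq_le c0 andbT -(cd0 i) lerDl.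
Qed.

Lemma posroot_cone b : Rp b -> cone b.
Proof. by case=> _ [c c0 ->]; exists c. Qed.

Lemma sroot_neq0 i : al i != 0.
Proof.
apply/eqP => /(congr1 (scoroot D i)); rewrite sroot_scoroot linear0.
by move/eqP; rewrite pnatr_eq0.
Qed.

Lemma root_sroot i : Defs.roots D (al i).
Proof. by exists 1%g, i; rewrite act1. Qed.

Lemma root_act x b : Defs.roots D b -> Defs.roots D (act x b).
Proof. by move=> [w [i ->]]; exists (x * w)%g, i; rewrite actM. Qed.

Lemma root_opp b : Defs.roots D b -> Defs.roots D (- b).
Proof.
move=> [w [i ->]]; exists (w * s i)%g, i.
by rewrite actM act_gen_sroot linearN.
Qed.

Lemma root_neq0 b : Defs.roots D b -> b != 0.
Proof.
move=> [w [i ->]]; apply/eqP => h; case/eqP: (sroot_neq0 i).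
by apply: (@act_inj w); rewrite h linear0.
Qed.

Lemma posrootN b : Rp b -> ~ Rp (- b).
Proof.
move=> bp /posroot_cone nb; have := root_neq0 bp.1.
by rewrite (coneN (posroot_cone bp) nb) eqxx.
Qed.

Lemma root_sign b : Defs.roots D b -> Rp b \/ Rp (- b).
Proof.
by rewrite Hroots.1 => -[|[c cp <-]]; [left|right; rewrite opprK].
Qed.

Lemma posroot_sroot i : Rp (al i).
Proof.
split; first exact: root_sroot.
exists (fun j => (j == i)%:R) => [j|]; first exact: ler0n.
rewrite (bigD1 i) //= eqxx scale1r big1 ?addr0 // => j /negPf ->.
by rewrite scale0r.
Qed.

Lemma inversionsE w b : inversions D w b <-> Rp b /\ Rp (- act w^-1%g b).
Proof.
split=> [[bp [_ [c cp <-] bE]]|[bp nb]].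
  by split=> //; rewrite -bE actK opprK.
split=> //; exists (act w^-1%g b); last by rewrite actVK.
by exists (- act w^-1%g b) => //; rewrite opprK.
Qed.

Lemma length_gen i : len (s i) = 1%N.
Proof.
apply/eqP; rewrite eqn_leq; apply/andP; split.
  by have := length_word C [:: i]; rewrite word_cons word_nil mulg1.
rewrite lt0n; apply/eqP => /length_eq0 si1; have := act_gen_sroot i.
rewrite si1 act1 => /eqP; rewrite -subr_eq0 opprK -mulr2n -scaler_nat.
by rewrite scaler_eq0 pnatr_eq0 /= (negPf (sroot_neq0 i)).
Qed.

(** The description of S(w) by reduced words is used here for words of one
    letter; it says that [s_i] permutes the positive roots other than the
    [i]-th simple root. *)
Lemma inversions_gen i b : inversions D (s i) b -> b = al i.
Proof.
have ri : reduced C [:: i].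
  by rewrite /reduced word_cons word_nil mulg1 length_gen.
have := (Hinv ri).2; rewrite word_cons word_nil mulg1 => ->.
move=> [[|j [|k u1]] [i' [u2 [//= [<- _]]]]].
by rewrite word_nil act1.
Qed.

Lemma posroot_gen i b : Rp b -> b <> al i -> Rp (act (s i) b).
Proof.
move=> bp bi; case: (root_sign (root_act (s i) bp.1)) => // nb; case: bi.
by apply: (@inversions_gen i); apply/inversionsE; rewrite gen_inv.
Qed.

(** The root system is reduced: a positive multiple of a simple root is sent by
    [s_i] to a negative root, hence is an inversion of [s_i]. *)
Lemma root_prop_sroot i c : 0 < c -> Defs.roots D (c *: al i) -> c *: al i = al i.
Proof.
move=> c0 cr; apply: inversions_gen; apply/inversionsE; rewrite gen_inv.
rewrite linearZ /= act_gen_sroot scalerN opprK; suff: Rp (c *: al i) by [].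
by split=> //; exact: coneZ (ltW c0) (posroot_cone (posroot_sroot i)).
Qed.

Lemma root_prop b c : 0 < c -> Defs.roots D b -> Defs.roots D (c *: b) -> c *: b = b.
Proof.
move=> c0 [w [i ->]] /(root_act w^-1%g); rewrite linearZ /= actK.
by move=> /(root_prop_sroot c0) /(congr1 (act w)); rewrite linearZ.
Qed.

Lemma inversions_reducedP u : reduced C u -> forall b,
  inversions D (word s u) b <-> exists u1 i u2, u = u1 ++ i :: u2 /\
                               b = act (word s u1) (al i).
Proof. by move=> ru b; rewrite (Hinv ru).2. Qed.

Lemma inversions0 w : (forall b, ~ inversions D w b) -> w = 1%g.
Proof.
have [[|i u] ru <-] := reduced_word C w => H; first by rewrite word_nil.
case: (H (al i)); apply/(inversions_reducedP ru).
by exists [::], i, u; rewrite word_nil act1.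
Qed.

(** [W] acts faithfully since an element without inversions has length zero. *)
Lemma act_faithful x y : (forall v, act x v = act y v) -> x = y.
Proof.
move=> xy; have xy1 v : act (x * y^-1)%g v = v by rewrite actM xy actVK.
suff h: (x * y^-1 = 1)%g by rewrite -[x](mulgK y^-1%g) invgK h mul1g.
apply: inversions0 => b /inversionsE[bp]; rewrite -{1}(xy1 b) actK.
exact: posrootN.
Qed.

(** A transvection along a simple root changes only one coordinate of a root.
    A positive root other than that simple root has another nonzero coordinate,
    so it stays positive: the transvection has no inversions. *)
Lemma transvection_eq1 t p :
  act t (al p) = al p -> (forall v, exists c, act t v = v + c *: al p) -> t = 1%g.
Proof.
move=> tp tE; apply: inversions0 => b /inversionsE[bp nb].
have [c cE] := tE (act t^-1%g b); rewrite actVK in cE.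
have tb : act t^-1%g b = b - c *: al p by rewrite {2}cE addrK.
have [d d0 bE] := posroot_cone bp; have [e e0 eE] := posroot_cone nb.
(* off [p], the coordinates of [b] and of [- t^-1 b] are nonnegative and opposite *)
have dp j : j != p -> d j = 0.
  move=> jp.
  have h : forall j, d j + e j - (j == p)%:R * c = 0.
    apply: sroot_indep; under eq_bigr do rewrite scalerBl scalerDl.
    rewrite sumrB big_split /= -bE -eE tb [X in _ - X](bigD1 p) //= eqxx mul1r.
    rewrite big1 ?addr0 => [|k /negPf ->]; last by rewrite mul0r scale0r.
    by rewrite opprB addrCA subrr addr0 subrr.
  have := h j; rewrite (negPf jp) mul0r subr0 => /eqP.
  by rewrite paddr_eq0 // => /andP[/eqP].
have {}bE : b = d p *: al p.
  by rewrite {1}bE (bigD1 p) //= big1 ?addr0 // => j /dp ->; rewrite scale0r.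
have dp0 : 0 < d p.
  rewrite lt_def d0 andbT; apply/eqP => d0'; have := root_neq0 bp.1.
  by rewrite bE d0' scale0r eqxx.
have {}bE : b = al p.
  by rewrite bE; apply: root_prop_sroot; rewrite -?bE //; exact: bp.1.
apply: (posrootN bp); suff {1}-> : b = act t^-1%g b by [].
by rewrite bE -{2}tp actK.
Qed.

Local Notation pr := (scoroot D).

Lemma dual_repE w y v : dual_rep D w y v = y (act w^-1%g v).
Proof. by rewrite comp_lfunE. Qed.

Lemma act_conj_gen w i v :
  act (w * s i * w^-1)%g v
    = v - (dual_rep D w (pr i) v : R) *: act w (al i).
Proof.
by rewrite !actM rep_gen linearB linearZ /= actVK dual_repE.
Qed.

(** If [w] maps a simple root to a simple root, the two reflections attached to
    the latter differ by a transvection, hence coincide, and so do the coroots.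
    This makes [coroot] well defined and equivariant. *)
Lemma coroot_sroot_unique w i p :
  act w (al i) = al p -> dual_rep D w (pr i) = pr p.
Proof.
move=> wip.
have t1 : (w * s i * w^-1 * s p = 1)%g.
  apply: (@transvection_eq1 _ p) => [|v].
    rewrite actM act_gen_sroot linearN /= act_conj_gen dual_repE -wip actK.
    by rewrite sroot_scoroot subr_double opprK.
  exists (- (pr p v : R) - (dual_rep D w (pr i) (act (s p) v) : R)).
  rewrite actM act_conj_gen wip rep_gen.
  by rewrite scalerBl addrA scaleNr.
apply/lfunP => v; have := act_conj_gen w i v.
have -> : (w * s i * w^-1 = s p)%g.
  by rewrite -[LHS]mulg1 -(gen_sqr C p) mulgA t1 mul1g.
rewrite rep_gen wip => /addrI /oppr_inj /eqP.
rewrite -subr_eq0 -scalerBl scaler_eq0 (negPf (sroot_neq0 p)) orbF subr_eq0.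
by move=> /eqP ->.
Qed.

Lemma corootE w i : coroot D (act w (al i)) = dual_rep D w (pr i).
Proof.
rewrite /coroot; apply: xget_unique; first by exists w, i.
move=> y [w' [i' [ww' ->]]].
have := @coroot_sroot_unique (w^-1 * w')%g i' i.
rewrite actM -ww' actK => /(_ erefl) h; apply/lfunP => v.
by rewrite [RHS]dual_repE -h !dual_repE invgM invgK actM actVK.
Qed.

Lemma coroot_sroot i : coroot D (al i) = pr i.
Proof.
rewrite -{1}[al i]act1 corootE; apply/lfunP => v.
by rewrite dual_repE invg1 act1.
Qed.

Lemma coroot_act w b v : Defs.roots D b ->
  coroot D (act w b) (act w v) = coroot D b v.
Proof.
move=> [x [i ->]]; rewrite -actM !corootE !dual_repE invgM actM actK.
by [].
Qed.

Lemma coroot_opp b v : Defs.roots D b -> coroot D (- b) v = - coroot D b v :> R.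
Proof.
move=> [x [i ->]].
have -> : - act x (al i) = act (x * s i)%g (al i).
  by rewrite actM act_gen_sroot linearN.
rewrite !corootE !dual_repE.
by rewrite invgM gen_inv actM rep_gen linearB linearZ /= sroot_scoroot
  /GRing.scale /= mulr2n mulrDr mulr1 opprD addrA subrr add0r.
Qed.

Lemma coroot_self b : Defs.roots D b -> coroot D b b = 2.
Proof. by move=> [w [i ->]]; rewrite corootE dual_repE actK sroot_scoroot. Qed.

Definition hrefl b (v : V) : V := v - (coroot D b v : R) *: b.

Lemma hrefl_act w b v : Defs.roots D b -> hrefl (act w b) (act w v) = act w (hrefl b v).
Proof. by move=> rb; rewrite /hrefl coroot_act // actB actZ. Qed.

Lemma hrefl_sroot i v : hrefl (al i) v = act (s i) v.
Proof. by rewrite /hrefl coroot_sroot rep_gen. Qed.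

Lemma root_refl_conj w i : root_refl D (act w (al i)) = (w * s i * w^-1)%g.
Proof.
apply: xget_unique => [v|t tE]; first by rewrite act_conj_gen corootE.
by apply: act_faithful => v; rewrite act_conj_gen tE corootE.
Qed.

Lemma act_root_refl b v : Defs.roots D b -> act (root_refl D b) v = hrefl b v.
Proof. by move=> [w [i ->]]; rewrite root_refl_conj act_conj_gen /hrefl corootE. Qed.

Lemma root_refl_sqr b : Defs.roots D b -> (root_refl D b * root_refl D b = 1)%g.
Proof.
move=> [w [i ->]]; rewrite root_refl_conj !mulgA mulgVK -(mulgA w) gen_sqr.
by rewrite mulg1 mulgV.
Qed.

Lemma root_refl_opp b : Defs.roots D b -> root_refl D (- b) = root_refl D b.
Proof.
move=> rb; apply: act_faithful => v.
rewrite !act_root_refl //; last exact: root_opp.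
by rewrite /hrefl coroot_opp // scalerN scaleNr opprK.
Qed.

Lemma root_refl_act w b : Defs.roots D b ->
  root_refl D (act w b) = (w * root_refl D b * w^-1)%g.
Proof.
by move=> [x [i ->]]; rewrite -actM !root_refl_conj invgM !mulgA.
Qed.

Lemma root_refl_reflection b : Defs.roots D b -> cox_reflections C (root_refl D b).
Proof. by move=> [w [i ->]]; rewrite root_refl_conj; exists w, i. Qed.

(** Strong exchange: an inversion [b] of [w] is obtained from some letter of a
    reduced word of [w], and multiplying by the reflection in [b] deletes that
    letter. *)
Lemma length_refl_lt b w : Rp b -> Rp (- act w^-1%g b) ->
  (len (root_refl D b * w)%g < len w)%N.
Proof.
have [u ru uw] := reduced_word C w; move=> bp nb.
have /(inversions_reducedP ru)[u1 [i [u2 [uE ->]]]] : inversions D (word s u) b.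
  by apply/inversionsE; rewrite uw.
rewrite -uw -ru root_refl_conj {1}uE word_cat word_cons !mulgA mulgVK.
rewrite -(mulgA (word s u1)) gen_sqr mulg1 -word_cat.
apply: leq_ltn_trans (length_word _ _) _.
by rewrite uE !size_cat /= addnS.
Qed.

Lemma length_refl_gt b w : Rp b -> Rp (act w^-1%g b) ->
  (len w < len (root_refl D b * w)%g)%N.
Proof.
move=> bp wb; have rb := bp.1; set t := root_refl D b.
have tw : w = (t * (t * w))%g by rewrite mulgA root_refl_sqr // mul1g.
rewrite {1}tw; apply: length_refl_lt => //; rewrite invgM actM.
have -> : (t^-1 = t)%g.
  by apply: (mulgI t); rewrite mulgV root_refl_sqr.
by rewrite act_root_refl // /hrefl coroot_self // subr_double linearN opprK.
Qed.

Lemma reduced_rcons_pos u i : reduced C (rcons u i) -> Rp (act (word s u) (al i)).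
Proof.
move=> ru; have : inversions D (word s (rcons u i)) (act (word s u) (al i)).
  by apply/inversions_reducedP => //; exists u, i, [::]; rewrite cats1.
by move/inversionsE => [].
Qed.


(** * Dominant vectors and minimal coset representatives *)

Variables (chi : V) (Hchi : dominant D chi).
Local Notation co b v := (coroot D b v : R).

(** Appending a letter [i] to a reduced word [u] subtracts
    [(chi, a_i^) u(a_i)] from [u chi], a nonnegative multiple of a positive
    root. *)
Lemma dominant_cone w : cone (chi - act w chi).
Proof.
have [u ru <-] := reduced_word C w.
elim/last_ind: u ru => [|u i IH] ru.
  by rewrite word_nil act1 subrr; exact: cone0.
rewrite -cats1 word_cat word_cons word_nil mulg1 actM rep_gen actB actZ.
rewrite opprB addrCA addrC; apply: coneD.
  by apply: IH; exact: reduced_rcons ru.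
apply: coneZ; first exact: Hchi.
exact: posroot_cone (reduced_rcons_pos ru).
Qed.

(** Positive roots might a priori have coroots of mixed sign, so dominance on
    simple coroots is transferred through [chi - s_g chi = (chi, g^) g]. *)
Lemma dominant_ge0 g : Rp g -> 0 <= co g chi.
Proof.
move=> gp; rewrite leNgt; apply/negP => c0.
have := dominant_cone (root_refl D g); rewrite act_root_refl; last exact: gp.1.
rewrite /hrefl opprB addrCA subrr addr0 => h.
have := root_neq0 gp.1; rewrite (coneN (posroot_cone gp)) ?eqxx //.
have := coneZ _ h; move=> /(_ (- (co g chi)^-1)).
rewrite oppr_ge0 invr_le0 (ltW c0) => /(_ isT).
by rewrite scalerA mulNr mulVf ?lt_eqF // scaleN1r.
Qed.

Variables (J : {set 'I_r}) (HJ : stabilizer D chi = parabolic C J).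
Local Notation minr := (min_rep C J).

Lemma stabP x : act x chi = chi <-> parabolic C J x.
Proof. by rewrite -HJ. Qed.

Lemma same_cosetP x y : same_coset C J x y <-> act x chi = act y chi.
Proof.
split=> [[u /stabP uJ ->]|xy]; first by rewrite actM uJ.
exists (x^-1 * y)%g; last by rewrite mulgA mulgV mul1g.
by apply/stabP; rewrite actM -xy actK.
Qed.

Lemma min_repE x : minr x <->
  (forall y, act y chi = act x chi -> (len x <= len y)%N).
Proof.
split=> H y; first by move=> h; apply: H; apply/same_cosetP; rewrite h.
by move=> /same_cosetP h; apply: H; rewrite h.
Qed.

Lemma min_rep_exists z : exists2 x, minr x & act x chi = act z chi.
Proof.
pose P n := `[< exists x, act x chi = act z chi /\ len x = n >].
have exP : exists n, P n by exists (len z); apply/asboolP; exists z.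
case: (ex_minnP exP) => n /asboolP[x [xz <-]] nmin.
exists x => //; apply/min_repE => y yx; apply: nmin.
by apply/asboolP; exists y; rewrite yx.
Qed.

(** The geometric form of minimality of [x] in its coset: [x] keeps the positive
    roots orthogonal to [chi] positive. *)
Definition fiber_positive x :=
  forall g, Rp g -> co g chi = 0 -> Rp (act x g).

Lemma act_refl_chi g : Defs.roots D g -> co g chi = 0 -> act (root_refl D g) chi = chi.
Proof. by move=> rg g0; rewrite act_root_refl // /hrefl g0 scale0r subr0. Qed.

Lemma length_Mrefl_lt x g : Rp g -> Rp (- act x g) ->
  (len (x * root_refl D g)%g < len x)%N.
Proof.
move=> gp xg; have rx := root_act x gp.1.
have -> : (x * root_refl D g = root_refl D (- act x g) * x)%g.
  by rewrite root_refl_opp // root_refl_act ?mulgVK //; exact: gp.1.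
by apply: length_refl_lt => //; rewrite actN actK opprK.
Qed.

Lemma min_rep_positive x : minr x -> fiber_positive x.
Proof.
move=> /min_repE xm g gp g0; case: (root_sign (root_act x gp.1)) => // xg.
have := length_Mrefl_lt gp xg; rewrite ltnNge xm //.
by rewrite actM act_refl_chi //; exact: gp.1.
Qed.

(** An inversion [b] of [u = x^-1 y], which fixes [chi], pairs to zero with
    [chi] by dominance of [chi]; then [x b > 0], while
    [y (- u^-1 b) = - x b > 0] as well. *)
Lemma fiber_positive_unique x y : fiber_positive x -> fiber_positive y ->
  act x chi = act y chi -> x = y.
Proof.
move=> xp yp xy; suff: (x^-1 * y = 1)%g 
  by move=> h; rewrite -[y](mul1g) -(mulgV x) -mulgA h mulg1.
have uchi : act (x^-1 * y)%g chi = chi by rewrite actM -xy actK.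
apply: inversions0 => b /inversionsE[bp]; set u := (x^-1 * y)%g in uchi *.
move=> nb; have ub : co (act u^-1%g b) chi = co b chi.
  rewrite -[in RHS](actVK u b) -[in RHS]uchi coroot_act //.
  exact: root_act bp.1.
have b0 : co b chi = 0.
  apply/eqP; rewrite eq_le dominant_ge0 // andbT -ub -oppr_ge0 -coroot_opp.
    exact: dominant_ge0.
  exact: root_act bp.1.
apply: (posrootN (xp _ bp b0)).
have := yp _ nb; rewrite coroot_opp ?ub ?b0 ?oppr0; last exact: root_act bp.1.
by move=> /(_ erefl); rewrite actN /u invgM invgK actM actVK.
Qed.

Lemma min_rep_unique x y : minr x -> minr y -> act x chi = act y chi -> x = y.
Proof.
by move=> /min_rep_positive xp /min_rep_positive yp; exact: fiber_positive_unique.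
Qed.

Definition Jspan (v : V) := exists2 c : 'I_r -> R,
  (forall i, i \notin J -> c i = 0) & v = \sum_i c i *: al i.

Lemma JspanD u v : Jspan u -> Jspan v -> Jspan (u + v).
Proof.
move=> [c c0 ->] [d d0 ->]; exists (fun i => c i + d i) => [i iJ|].
  by rewrite c0 // d0 // addr0.
by rewrite -big_split; apply: eq_bigr => i _; rewrite scalerDl.
Qed.

Lemma JspanZ a v : Jspan v -> Jspan (a *: v).
Proof.
move=> [c c0 ->]; exists (fun i => a * c i) => [i iJ|].
  by rewrite c0 // mulr0.
by rewrite scaler_sumr; apply: eq_bigr => i _; rewrite scalerA.
Qed.

Lemma Jspan_parabolic x : parabolic C J x -> forall v, Jspan (act x v - v).
Proof.
elim=> [i iJ|| y z _ IHy _ IHz|y _ IH] v.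
- exists (fun j => - (j == i)%:R * (scoroot D i v : R)) => [j jJ|].
    case: eqP => [ji|_]; last by rewrite oppr0 mul0r.
    by rewrite ji iJ in jJ.
  rewrite rep_gen (bigD1 i) //= eqxx big1 ?addr0 => [|j /negPf ->].
    by rewrite mulN1r scaleNr addrC addKr.
  by rewrite oppr0 mul0r scale0r.
- by rewrite act1 subrr; exists (fun=> 0) => //; rewrite big1 // => i _; rewrite scale0r.
- by rewrite actM -[_ - v](subrKA (act z v)); apply: JspanD.
- have := IH (act y^-1%g v); rewrite actVK => /(JspanZ (-1)).
  by rewrite scaleN1r opprB.
Qed.

(** A root [g] orthogonal to [chi] lies in the span of the simple roots in [J]:
    its reflection is in W_J, hence moves [g] to [- g] by a vector of that
    span. *)
Lemma fiber_root_Jcone g : Rp g -> co g chi = 0 ->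
  exists2 c : 'I_r -> R, (forall i, 0 <= c i /\ (i \notin J -> c i = 0)) &
    g = \sum_i c i *: al i.
Proof.
move=> gp g0; have := act_refl_chi gp.1 g0 => /stabP /Jspan_parabolic /(_ g).
rewrite act_root_refl; last exact: gp.1.
rewrite /hrefl coroot_self ?subr_double; last exact: gp.1.
rewrite -opprD -mulr2n -scaler_nat -scaleNr => /(JspanZ (- (2%:R)^-1)).
rewrite scalerA mulrNN mulVf ?pnatr_eq0 // scale1r => -[c cJ cE].
have [d d0 dE] := posroot_cone gp; exists d => // i; split=> // iJ.
have h : forall i, c i - d i = 0.
  apply: sroot_indep; under eq_bigr do rewrite scalerBl.
  by rewrite sumrB -cE -dE subrr.
by have := h i; rewrite cJ // sub0r => /eqP; rewrite oppr_eq0 => /eqP.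
Qed.

(** A simple descent in [J] is needed, rather than any root orthogonal to [chi],
    because removing it from both [z] and [s_b z] in [min_rep_refl_le] preserves
    the positivity of [z^-1 b], unless [z] and [s_b z] are in the same coset. *)
Lemma fiber_positive_descent x :
  fiber_positive x \/ exists2 j, j \in J & Rp (- act x (al j)).
Proof.
have [[j jJ xj]|H] := pselect (exists2 j, j \in J & Rp (- act x (al j))).
  by right; exists j.
left=> g gp g0; case: (root_sign (root_act x gp.1)) => // xg.
suff h : cone (act x g).
  have := root_neq0 (root_act x gp.1).
  by rewrite (coneN h (posroot_cone xg)) eqxx.
have [c cP ->] := fiber_root_Jcone gp g0.
rewrite linear_sum /=.
apply: (big_ind cone) => [||i _]; [exact: cone0|exact: coneD|].
have [iJ|iJ] := boolP (i \in J); last first.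
  by rewrite (cP i).2 // scale0r linear0; exact: cone0.
rewrite actZ; apply: coneZ; first exact: (cP i).1.
case: (root_sign (root_act x (root_sroot i))) => [/posroot_cone //|xi].
by case: H; exists i.
Qed.

Lemma act_Mgen_chi x j : j \in J -> act (x * s j)%g chi = act x chi.
Proof.
by move=> jJ; rewrite actM; have /stabP -> := parabolic_gen C jJ.
Qed.

Lemma root_refl_sroot i : root_refl D (al i) = s i.
Proof. by rewrite -[al i]act1 root_refl_conj mul1g invg1 mulg1. Qed.

Lemma min_rep_le x z : minr x -> act x chi = act z chi -> bruhat_le C x z.
Proof.
move=> xm; have [n] := ubnP (len z); elim: n z => // n IH z lz xz.
have [zp|[j jJ zj]] := fiber_positive_descent z.
  have -> : z = x by apply: fiber_positive_unique => //; exact: min_rep_positive.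
  exact: bruhat_refl.
have lt := length_Mrefl_lt (posroot_sroot j) zj; rewrite root_refl_sroot in lt.
have -> : (z = root_refl D (act z (al j)) * (z * s j))%g.
  rewrite root_refl_act ?root_refl_sroot; last exact: root_sroot.
  by rewrite mulgA mulgVK -mulgA gen_sqr mulg1.
apply: bruhat_step.
- by apply: IH; [exact: leq_trans lt lz | rewrite act_Mgen_chi].
- by apply: root_refl_reflection; exact: root_act (root_sroot j).
- rewrite root_refl_act ?root_refl_sroot; last exact: root_sroot.
  by rewrite mulgA mulgVK -mulgA gen_sqr mulg1.
Qed.

(** Passing to minimal coset representatives preserves the relation [z < s_b z]
    up to equality: remove right descents in [J] from
    [s_b z], and from [z] at the same time, until [s_b z] is minimal. *)
Lemma min_rep_refl_le x y z b : minr x -> minr y ->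
  Rp b -> Rp (act z^-1%g b) ->
  act x chi = act z chi -> act y chi = act (root_refl D b * z)%g chi ->
  bruhat_le C x y.
Proof.
move=> xm ym bp; have [n] := ubnP (len (root_refl D b * z)%g).
elim: n z => // n IH z lz zb xz yz.
have [tp|[j jJ tj]] := fiber_positive_descent (root_refl D b * z)%g.
  have -> : y = (root_refl D b * z)%g.
    by apply: fiber_positive_unique => //; exact: min_rep_positive.
  apply: bruhat_step; first exact: min_rep_le.
    exact: root_refl_reflection bp.1.
  exact: length_refl_gt.
have [zbj|zbj] := pselect (act z^-1%g b = al j).
  have -> : y = x; last exact: bruhat_refl.
  apply: min_rep_unique => //; rewrite yz xz.
  have -> : b = act z (al j) by rewrite -zbj actVK.
  rewrite root_refl_act ?root_refl_sroot; last exact: root_sroot.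
  by rewrite mulgVK act_Mgen_chi.
apply: (IH (z * s j)%g); rewrite ?mulgA ?act_Mgen_chi //.
  have := length_Mrefl_lt (posroot_sroot j) tj; rewrite root_refl_sroot => lt.
  exact: leq_trans lt lz.
by rewrite invgM gen_inv actM; exact: posroot_gen.
Qed.

(** * Edges as reflections in the orbit *)

Lemma coroot_orbit x b : Defs.roots D b -> co b (act x chi) = co (act x^-1%g b) chi.
Proof.
by move=> rb; rewrite -{1}(actVK x b) coroot_act //; exact: root_act.
Qed.

Lemma coroot_orbit_pos x b : Rp b -> 0 < co b (act x chi) -> Rp (act x^-1%g b).
Proof.
move=> bp; rewrite coroot_orbit; last exact: bp.1.
case: (root_sign (root_act x^-1%g bp.1)) => // nb.
have := dominant_ge0 nb; rewrite coroot_opp; last exact: root_act bp.1.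
by rewrite oppr_ge0 leNgt => /negPf ->.
Qed.

Lemma hreflK b v : Defs.roots D b -> hrefl b (hrefl b v) = v.
Proof.
by move=> rb; rewrite -!act_root_refl // -actM root_refl_sqr // act1.
Qed.

Lemma coroot_hrefl b v : Defs.roots D b -> co b (hrefl b v) = - co b v.
Proof.
move=> rb; rewrite /hrefl linearB linearZ /= coroot_self //.
by rewrite /GRing.scale /= mulr_natr mulr2n opprD addrA subrr add0r.
Qed.

Lemma edge_lt x y b : minr x -> minr y -> Rp b ->
  act y chi = hrefl b (act x chi) -> 0 < co b (act x chi) -> bruhat_lt C x y.
Proof.
move=> xm ym bp yE c0; split.
  apply: (@min_rep_refl_le x y x b) => //; first exact: coroot_orbit_pos.
  by rewrite actM act_root_refl //; exact: bp.1.
move=> xy; move: yE; rewrite -xy /hrefl -[LHS]subr0 => /addrI /oppr_inj /esym/eqP.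
by rewrite scaler_eq0 (gt_eqF c0) (negPf (root_neq0 bp.1)).
Qed.

(** The three possible signs of [(y chi, b^)]: zero would force [x = y] by
    uniqueness of minimal representatives, and a positive value would give an
    edge in the opposite direction. *)
Lemma edgeP x b y : edge D J x b y <->
  [/\ minr x, minr y, Rp b, act x chi = hrefl b (act y chi) &
      co b (act y chi) < 0].
Proof.
split=> [[xm ym bp /same_cosetP]|[xm ym bp xy c0]].
  rewrite actM act_root_refl; last exact: bp.1.
  move=> xy [xley xney]; have yx : act x chi = hrefl b (act y chi).
    by rewrite -xy hreflK //; exact: bp.1.
  split=> //; rewrite ltNge le_eqVlt; apply/orP => -[/eqP c0|c0].
    apply: xney; apply: min_rep_unique => //.
    by rewrite yx /hrefl -c0 scale0r subr0.
  have [yle _] := edge_lt ym xm bp yx c0.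
  case: (bruhat_length xley) => // l1; case: (bruhat_length yle) => [/esym //|l2].
  by have := ltn_trans l1 l2; rewrite ltnn.
have yx : act y chi = hrefl b (act x chi).
  by rewrite xy hreflK //; exact: bp.1.
split=> //.
  by apply/same_cosetP; rewrite actM act_root_refl //; exact: bp.1.
apply: (@edge_lt _ _ b) => //; rewrite xy coroot_hrefl ?oppr_gt0 //; exact: bp.1.
Qed.

Lemma edge_length x b y : edge D J x b y -> (len x < len y)%N.
Proof. by case=> _ _ _ _ [/bruhat_length[]]. Qed.

(** Any root [g] defining the edge satisfies [(chi, g^) x g = m b] with [m > 0],
    so [x g] is a positive multiple of [b], hence equal to [b]. *)
Lemma edge_mult x b y : edge D J x b y ->
  co (edge_root D J x y) chi = - co b (act y chi).
Proof.
move=> /edgeP[xm ym bp xy c0].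
have rb : Defs.roots D b := bp.1.
have yx : act y chi = hrefl b (act x chi) by rewrite xy hreflK.
have c0' : 0 < co b (act x chi) by rewrite xy coroot_hrefl // oppr_gt0.
rewrite /edge_root; case: xgetP => [g _ [gp /same_cosetP]|]; last first.
  move=> /(_ (act x^-1%g b)) []; split; first exact: coroot_orbit_pos.
  apply/same_cosetP; rewrite root_refl_act // invgK mulgA mulgA mulgV mul1g.
  by rewrite actM act_root_refl.
have rg : Defs.roots D g := gp.1.
rewrite actM act_root_refl // {1}/hrefl actB actZ yx /hrefl => /addrI /oppr_inj gb.
have m0 : co g chi != 0.
  apply: contraTneq c0' => m0; rewrite m0 scale0r in gb.
  move/esym/eqP: gb; rewrite scaler_eq0 (negPf (root_neq0 rb)) orbF => /eqP ->.
  by rewrite ltxx.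
have m0' : 0 < co g chi by rewrite lt_def m0 dominant_ge0.
have xg : act x g = (co b (act x chi) / co g chi) *: b.
  by rewrite mulrC -scalerA -gb scalerA mulVf // scale1r.
have xgb : act x g = b.
  by rewrite xg; apply: root_prop => //; rewrite ?divr_gt0 // -xg; exact: root_act.
by rewrite -(coroot_act x) // xgb -/(hrefl _ _) coroot_hrefl // opprK.
Qed.

Definition descents mu : set V := [set b | Rp b /\ co b mu < 0].

(** Outside the orbit of [chi] a vector may have infinitely many descents; those
    of [y chi] are inversions of [y]. *)
Lemma descents_finite y : finite_set (descents (act y chi)).
Proof.
apply: (@sub_finite_set _ _ (inversions D y)) => [b [bp b0]|]; last first.
  have [u ru <-] := reduced_word C y.
  by apply/finite_setP; exists (size u); exact: (Hinv ru).1.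
apply/inversionsE; split=> //.
case: (root_sign (root_act y^-1%g bp.1)) => // yb.
by have := dominant_ge0 yb; rewrite -coroot_orbit ?leNgt ?b0 //; exact: bp.1.
Qed.


(** * Deletion sums and the descent operator *)

Section Functional.
Variables (K : fieldType) (cst : {rmorphism R -> K}).

Definition generic (phi : V -> K) : Prop :=
  (forall a u v, phi (a *: u + v) = cst a * phi u + phi v) /\
  (forall v, phi v = 0 -> v = 0).

Definition descent_sum (f : V -> K) (mu : V) : K :=
  \sum_(b \in descents mu) cst (- co b mu) * f (hrefl b mu).

Lemma generic0 phi : generic phi -> phi 0 = 0.
Proof.
move=> [pl _]; have := pl 1 0 0; rewrite scaler0 addr0 rmorph1 mul1r.
by move=> /eqP; rewrite -subr_eq0 opprD addrA subrr sub0r oppr_eq0 => /eqP.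
Qed.

Lemma generic_act phi x : generic phi -> generic (phi \o act x).
Proof.
move=> [pl p0]; split=> [a u v|v /p0 h] /=; first by rewrite actD actZ pl.
by apply: (@act_inj x); rewrite h linear0.
Qed.

Lemma descent_sum_split i f y (mu := act y chi) : descent_sum f mu =
  (if co (al i) mu < 0 then cst (- co (al i) mu) * f (act (s i) mu) else 0) +
  \sum_(b \in descents mu `\ al i) cst (- co b mu) * f (hrefl b mu).
Proof.
rewrite /descent_sum; have fin := descents_finite y; case: ifP => c0.
  rewrite (fsbigD1 (al i)) /= ?hrefl_sroot //.
  by split=> //; exact: posroot_sroot.
rewrite add0r not_setD1 // => -[_]; by rewrite c0.
Qed.

(** The descents of [mu] and of [s_i mu] correspond under [s_i], apart from the
    [i]-th simple root, which is a descent of exactly one of the two unless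
    [s_i mu = mu]; in all three cases its contribution is the last term. *)
Lemma descent_sum_gen i f y (mu := act y chi) :
  descent_sum f (act (s i) mu)
    = descent_sum (f \o act (s i)) mu + cst (co (al i) mu) * f mu.
Proof.
rewrite {1}/mu -actM (descent_sum_split i) (descent_sum_split i) actM -/mu.
have cs : co (al i) (act (s i) mu) = - co (al i) mu.
  by rewrite -hrefl_sroot coroot_hrefl //; exact: root_sroot.
rewrite cs act_genK /= act_genK opprK addrAC; congr (_ + _).
  rewrite oppr_lt0; have [c0|c0|c0] := ltgtP (co (al i) mu) 0.
  - by rewrite rmorphN mulNr addNr.
  - by rewrite add0r.
  - by rewrite c0 rmorph0 mul0r addr0.
rewrite (reindex_fsbig (act (s i)) (descents mu `\ al i)).
  apply: eq_fsbigr => b /set_mem [[bp _] _].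
  by rewrite coroot_act ?hrefl_act //; exact: bp.1.
split=> [b [[bp b0] bi]|b c _ _ /act_inj //|b [[bp b0] bi]].
  split; first split; first exact: posroot_gen.
    by rewrite coroot_act //; exact: bp.1.
  move=> sb; have := posrootN bp; rewrite -(act_genK i b) sb act_gen_sroot.
  by rewrite opprK; apply; exact: posroot_sroot.
exists (act (s i) b); last exact: act_genK.
split; first split; first exact: posroot_gen.
  by rewrite -[mu](act_genK i) coroot_act //; exact: bp.1.
move=> sb; have := posrootN bp; rewrite -(act_genK i b) sb act_gen_sroot.
by rewrite opprK; apply; exact: posroot_sroot.
Qed.

(** Precomposing [phi] with [s_i] is the action of [s_i] on the coefficients
    produced by the rest of the word; in the second summand the letter [i] has
    been deleted, at the price of a factor [1 / phi (al i)]. *)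
Fixpoint deletion_sum (phi : V -> K) (u : seq 'I_r) (k : nat) (f : V -> K) : K :=
  match u with
  | [::] => if k is 0%N then f chi else 0
  | i :: u' => deletion_sum (phi \o act (s i)) u' k (f \o act (s i)) +
      (if k is k'.+1 then deletion_sum (phi \o act (s i)) u' k' f / phi (al i) else 0)
  end.

Lemma eq_deletion_sum phi u k f g : (forall y, f (act y chi) = g (act y chi)) ->
  deletion_sum phi u k f = deletion_sum phi u k g.
Proof.
elim: u phi k f g => [|i u IH] phi k f g fg /=.
  by have := fg 1%g; rewrite act1 => ->.
congr (_ + _); first by apply: IH => y /=; rewrite -actM.
by case: k => // k; congr (_ / _); exact: IH.
Qed.

Lemma deletion_sum_linear phi u k f g c :
  deletion_sum phi u k (fun mu => f mu * c + g mu)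
    = deletion_sum phi u k f * c + deletion_sum phi u k g.
Proof.
elim: u phi k f g => [|i u IH] phi k f g /=.
  by case: k => //; rewrite mul0r addr0.
rewrite (IH _ _ (f \o act (s i)) (g \o act (s i))).
case: k => [|k]; first by rewrite !addr0.
by rewrite IH; ring.
Qed.

Lemma deletion_sum0 phi u f : deletion_sum phi u 0 f = f (act (word s u) chi).
Proof.
elim: u phi f => [|i u IH] phi f /=; first by rewrite word_nil act1.
by rewrite addr0 IH word_cons actM.
Qed.

Lemma deletion_sum_large phi u k f : (size u < k)%N -> deletion_sum phi u k f = 0.
Proof.
elim: u phi k f => [|i u IH] phi [|k] f //= uk.
by rewrite !IH ?mul0r ?addr0 // ltnW.
Qed.

Lemma descent_sum_dominant f : descent_sum f chi = 0.
Proof.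
rewrite /descent_sum fsbig1 // => b /= [bp b0].
by have := dominant_ge0 bp; rewrite leNgt b0.
Qed.

(** Chevalley-type formula.  In passing from [u] to [i :: u] the error term of
    [descent_sum_gen] is cancelled by the difference between [mu] and [s_i mu]
    in the summand where the letter [i] has been deleted. *)
Lemma deletion_sum_rec phi u k f (nu := act (word s u) chi) : generic phi ->
  deletion_sum phi u k.+1 (fun mu => f mu * phi (mu - nu))
    = deletion_sum phi u k (descent_sum f).
Proof.
rewrite {}/nu; elim: u phi k f => [|i u IH] phi k f pg.
  by case: k => //=; rewrite descent_sum_dominant.
have pg' := generic_act (s i) pg; have pl := pg.1.
have pi0 : phi (al i) != 0.
  by apply/eqP => /pg.2 ai; have := sroot_neq0 i; rewrite ai eqxx.
rewrite /=; set phi' := phi \o _ in pg' *; set nu := act (word s u) chi.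
have nuE : act (word s (i :: u)) chi = act (s i) nu by rewrite word_cons actM.
rewrite nuE (@eq_deletion_sum _ _ _ _ (fun mu => (f \o act (s i)) mu * phi' (mu - nu)));
  last by move=> y; rewrite /phi' /= actB.
rewrite IH //.
rewrite [X in _ + X / _](@eq_deletion_sum _ _ k _
  (fun mu => f mu * cst (co (al i) mu) * phi (al i) +
                             f mu * phi' (mu - nu))); last first.
  move=> y /=; rewrite -mulrA -mulrDr; congr (_ * _); rewrite -pl /phi' /= actB.
  rewrite -(hrefl_sroot i (act y chi)) /hrefl addrA.
  by congr (phi (_ - _)); rewrite addrC subrK.
rewrite deletion_sum_linear mulrDl mulfK // addrA.
rewrite [in RHS](@eq_deletion_sum _ _ k _ (fun mu => f mu * cst (co (al i) mu) * 1 +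
                             descent_sum (f \o act (s i)) mu)); last first.
  by move=> y /=; rewrite descent_sum_gen mulr1 addrC (mulrC (f _)).
rewrite deletion_sum_linear mulr1 [X in X + _ = _]addrC; congr (_ + _).
case: k => [|k]; last by rewrite IH.
by rewrite deletion_sum0 subrr generic0 // mulr0 mul0r.
Qed.

(** The combination of orbit points is supported above [nu]: dividing by
    [_ - nu], the previous formula decreases [k], and the descent operator at
    [mu] evaluates at points [s_b mu] higher than [mu]. *)
Lemma deletion_sum_vanish phi u k f (nu := act (word s u) chi) : generic phi ->
  (forall mu, cone (mu - nu) -> f mu = 0) -> deletion_sum phi u k f = 0.
Proof.
move=> pg; elim: k f => [|k IH] f f0.
  by rewrite deletion_sum0 f0 // subrr; exact: cone0.
rewrite (@eq_deletion_sum _ _ _ _ (fun mu => f mu / phi (mu - nu) * phi (mu - nu))).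
  rewrite deletion_sum_rec //; apply: IH => mu mn.
  rewrite /descent_sum fsbig1 // => b [bp b0].
  rewrite f0 ?mul0r ?mulr0 // /hrefl addrAC -scaleNr; apply: coneD => //.
  by apply: coneZ; [rewrite oppr_ge0 ltW|exact: posroot_cone].
move=> y; have [p0|p0] := eqVneq (phi (act y chi - nu)) 0; last by rewrite divfK.
by rewrite p0 mulr0 f0 // (pg.2 _ p0); exact: cone0.
Qed.

(** A reduced word of a minimal coset representative. *)
Definition minimal_word u :=
  forall z, act z chi = act (word s u) chi -> (size u <= len z)%N.

Lemma minimal_word_cons i u : minimal_word (i :: u) -> minimal_word u.
Proof.
move=> um z zE; have := um (s i * z)%g; rewrite word_cons !actM zE.
by move=> /(_ erefl) /leq_trans /(_ (length_genM C i z)).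
Qed.

Lemma minimal_word_reduced u : minimal_word u -> reduced C u.
Proof. by move=> um; apply/eqP; rewrite eqn_leq um // length_word. Qed.

(** Prepending [i] increases the length, so the pairing is nonnegative; if it
    were zero, [u] would be a shorter word for the same coset. *)
Lemma minimal_word_coroot i u : minimal_word (i :: u) ->
  0 < co (al i) (act (word s u) chi).
Proof.
move=> um; set x := word s u.
have ri := root_sroot i; have rx := root_act x^-1%g ri.
have ux : len x = size u.
  by apply/esym/minimal_word_reduced; exact: minimal_word_cons um.
have ix : (len x < len (s i * x)%g)%N.
  by rewrite ux -word_cons -(minimal_word_reduced um).
have xp : Rp (act x^-1%g (al i)).
  case: (root_sign rx) => // nx; have := length_refl_lt (posroot_sroot i) nx.
  by rewrite root_refl_sroot ltnNge (ltnW ix).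
rewrite lt_def coroot_orbit // dominant_ge0 // andbT -coroot_orbit //.
apply/eqP => c0; have := um x; rewrite ux /= ltnn word_cons actM -hrefl_sroot.
by rewrite /hrefl c0 scale0r subr0 => /(_ erefl).
Qed.


(** If the letter [i] is deleted, the remaining points lie above the endpoint of
    [u], whereas the endpoint of [i :: u] lies strictly below it. *)
Lemma deletion_sum_fiber phi u k f : generic phi -> minimal_word u ->
  (forall mu, mu <> act (word s u) chi -> f mu = 0) -> deletion_sum phi u k.+1 f = 0.
Proof.
elim: u phi k f => [//|i u IH] phi k f pg um f0 /=.
set nu := act (word s u) chi; have pg' := generic_act (s i) pg.
have nuE : act (word s (i :: u)) chi = act (s i) nu by rewrite word_cons actM.
rewrite IH ?add0r //; first last.
- by move=> mu ne /=; apply: f0; rewrite nuE => /act_inj.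
- exact: minimal_word_cons um.
rewrite (deletion_sum_vanish k pg') ?mul0r // => mu mn; apply: f0 => muE.
move: mn; rewrite muE nuE -hrefl_sroot /hrefl addrAC subrr add0r => mn.
have c0 := minimal_word_coroot um.
have := coneN (coneZ (ltW c0) (posroot_cone (posroot_sroot i))) mn.
by move=> /eqP; rewrite scaler_eq0 (negPf (sroot_neq0 i)) gt_eqF.
Qed.

Definition descent_step phi nu (f : V -> K) : V -> K :=
  descent_sum (fun mu => f mu / phi (mu - nu)).

(** Off [nu], [f] is a multiple of [_ - nu], which [deletion_sum_rec] handles;
    its value at [nu] is invisible to deletion sums with [k > 0], which matches
    the convention that division by zero gives zero. *)
Lemma deletion_sum_iter phi u k f (nu := act (word s u) chi) :
  generic phi -> minimal_word u ->
  deletion_sum phi u k f = iter k (descent_step phi nu) f nu.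
Proof.
move=> pg um; elim: k f => [|k IH] f; first by rewrite deletion_sum0.
rewrite iterSr -IH -deletion_sum_rec // -/nu.
(* the part of [f] carried by [nu] *)
pose g mu : K := if mu == nu then f mu else 0.
rewrite (@eq_deletion_sum _ _ _ f
  (fun mu => g mu * 1 + f mu / phi (mu - nu) * phi (mu - nu))).
  rewrite deletion_sum_linear deletion_sum_fiber ?mul0r ?add0r // => mu /eqP mn.
  by rewrite /g (negPf mn).
move=> y; rewrite /g; case: eqVneq => [->|ne].
  by rewrite subrr generic0 // mulr0 addr0 mulr1.
rewrite mul0r add0r divfK //; apply: contra_neq ne => /pg.2.
by move/eqP; rewrite subr_eq0 => /eqP.
Qed.

Fixpoint word_roots (u : seq 'I_r) : seq V :=
  if u is i :: u' then al i :: map (act (s i)) (word_roots u') else [::].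

Lemma word_rootsP u b : b \in word_roots u <->
  exists u1 i u2, u = u1 ++ i :: u2 /\ b = act (word s u1) (al i).
Proof.
elim: u b => [|j u IH] b /=; first by split=> // -[[|? ?] [? [? []]]].
rewrite inE; split=> [/orP[/eqP->|/mapP[c /IH[u1 [i [u2 [-> ->]]]] ->]]|].
- by exists [::], j, u; rewrite word_nil act1.
- by exists (j :: u1), i, u2; rewrite word_cons actM.
move=> [[|j' u1] [i [u2 [/= [-> uE] ->]]]]; first by rewrite word_nil act1 eqxx.
apply/orP; right; apply/mapP; exists (act (word s u1) (al i)).
  by apply/IH; exists u1, i, u2.
by rewrite word_cons actM.
Qed.

Lemma word_roots_inversions u : reduced C u ->
  inversions D (word s u) = [set` word_roots u].
Proof.
by move=> ru; apply/seteqP; split=> b /=; rewrite inversions_reducedP // word_rootsP.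
Qed.

Lemma word_roots_uniq u : minimal_word u -> uniq (word_roots u).
Proof.
elim: u => //= i u IH um; have um' := minimal_word_cons um.
rewrite map_inj_uniq ?IH ?andbT //; last exact: act_inj.
apply/mapP => -[b bu ib]; have : inversions D (word s u) b.
  by rewrite word_roots_inversions //; exact: minimal_word_reduced.
move=> /inversionsE[bp _]; apply: (posrootN bp).
by rewrite -(act_genK i b) -ib act_gen_sroot opprK; exact: posroot_sroot.
Qed.

Lemma deletion_sum_total phi u n : (size u <= n)%N ->
  \sum_(k < n.+1) deletion_sum phi u k (fun=> 1)
    = \prod_(b <- word_roots u) (1 + 1 / phi b).
Proof.
elim: u phi n => [|i u IH] phi n un.
  by rewrite big_nil big_ord_recl big1 ?addr0.
case: n un => // n un; set psi := phi \o act (s i).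
pose T k := deletion_sum psi u k (fun=> 1).
have TE (k : 'I_n.+2) : true -> deletion_sum phi (i :: u) k (fun=> 1) =
    T k + (if k : nat is k'.+1 then T k' / phi (al i) else 0) by [].
rewrite (eq_bigr _ TE) big_split big_cons big_map /= [X in X + _](IH psi n.+1 (ltnW un)).
rewrite [X in _ + X]big_ord_recl add0r.
have -> : \sum_(k < n.+1) T k / phi (al i) =
    (\prod_(b <- word_roots u) (1 + 1 / psi b)) / phi (al i).
  by rewrite -mulr_suml (IH psi n un).
by rewrite div1r mulrDl mul1r mulrC.
Qed.

Lemma deletion_sum_top phi u :
  deletion_sum phi u (size u) (fun=> 1) = \prod_(b <- word_roots u) (1 / phi b).
Proof.
elim: u phi => [|i u IH] phi /=; first by rewrite big_nil.
by rewrite big_cons big_map deletion_sum_large // add0r IH mul1r mulrC.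
Qed.

End Functional.

(** * Paths and their weights *)

Section Paths.
Local Notation K := (QSym V).
Local Notation phi := (@QSym_in R V).
Local Notation cst := (@QSym_const R V : {rmorphism R -> K}).

(** Nonzero vectors stay nonzero in Q(V): by the universal property of the
    symmetric algebra, each coordinate of [V] factors through it. *)
Lemma QSym_in_generic : generic cst phi.
Proof.
split=> [a u v|v].
  rewrite /= /QSym_in /QSym_const -[in RHS]tofracM -tofracD; congr (FracField.tofrac _).
  rewrite /Sym_in mulr_algl scaler_sumr -big_split /=; apply: eq_bigr => i _.
  by rewrite linearD linearZ /= scalerDl scalerA.
move/eqP; rewrite /QSym_in tofrac_eq0 => /eqP v0.
rewrite [v](coord_vbasis (memvf v)) big1 // => i _.
have [psi [psiE _]] := @Sym_universal R V R^o (coord (vbasis {:V}) i).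
by rewrite -psiE v0 rmorph0 scale0r.
Qed.

Definition endpoint (w : W) (p : seq (V * W)) : W := last w [seq q.2 | q <- p].

Lemma endpointE w p : endpoint w p = path_vertex w p (size p).
Proof. by rewrite /endpoint (last_nth 1%g) size_map. Qed.

Lemma endpoint_rcons w p q : endpoint w (rcons p q) = q.2.
Proof. by rewrite /endpoint map_rcons last_rcons. Qed.

Lemma path_vertex_rcons (w : W) (p : seq (V * W)) q i : (i <= size p)%N ->
  path_vertex w (rcons p q) i = path_vertex w p i.
Proof.
move=> ip; rewrite /path_vertex map_rcons -rcons_cons nth_rcons /= size_map.
by rewrite ltnS ip.
Qed.

Lemma path_root_rcons (p : seq (V * W)) q i : (0 < i <= size p)%N ->
  path_root (rcons p q) i = path_root p i.
Proof.
by case: i => // i /= ip; rewrite /path_root map_rcons nth_rcons size_map ip.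
Qed.

Lemma path_root_last (p : seq (V * W)) q : path_root (rcons p q) (size p).+1 = q.1.
Proof. by rewrite /path_root map_rcons nth_rcons size_map ltnn eqxx. Qed.

Lemma path_vertex_last (w : W) (p : seq (V * W)) q :
  path_vertex w (rcons p q) (size p).+1 = q.2.
Proof. by rewrite -(endpoint_rcons w p q) endpointE size_rcons. Qed.

Lemma paths_to_nil w : paths_to D J w [::].
Proof. by case. Qed.

Lemma paths_to_rcons w p q : paths_to D J w (rcons p q) <->
  paths_to D J w p /\ edge D J q.2 q.1 (endpoint w p).
Proof.
split=> [H|[H e] i].
  split=> [i ip|]; last first.
    have := H (size p).+1; rewrite size_rcons ltnSn /= => /(_ isT).
    by rewrite path_vertex_last path_root_last path_vertex_rcons // endpointE.
  have [i0 ip'] := andP ip; have := H i; rewrite size_rcons i0 ltnW //= => /(_ isT).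
  by rewrite !path_vertex_rcons ?path_root_rcons // (leq_trans (leq_pred i)).
rewrite size_rcons; case: i => // i /=; rewrite ltnS leq_eqVlt => /orP[/eqP->|ip].
  by rewrite path_vertex_last path_root_last path_vertex_rcons // -endpointE.
rewrite !path_vertex_rcons ?path_root_rcons // 1?ltnW //.
by apply: (H i.+1).
Qed.

Lemma paths_to_length w p : paths_to D J w p -> (len (endpoint w p) + size p <= len w)%N.
Proof.
elim/last_ind: p => [|p q IH]; first by rewrite addn0.
move=> /paths_to_rcons[/IH H /edge_length lt]; apply: leq_trans H.
by rewrite endpoint_rcons size_rcons addnS -addSn leq_add2r.
Qed.

Lemma paths_to_min w p : minr w -> paths_to D J w p -> minr (endpoint w p).
Proof.
move=> wm; elim/last_ind: p => // p q _ /paths_to_rcons[_ []].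
by rewrite endpoint_rcons.
Qed.

Lemma path_mult_rcons w p q i : (0 < i <= size p)%N ->
  path_mult D J chi w (rcons p q) i = path_mult D J chi w p i.
Proof.
move=> /andP[i0 ip]; rewrite /path_mult !path_vertex_rcons //.
exact: leq_trans (leq_pred i) ip.
Qed.

Lemma path_mult_last w p q : paths_to D J w (rcons p q) ->
  path_mult D J chi w (rcons p q) (size p).+1 = - co q.1 (act (endpoint w p) chi).
Proof.
move=> /paths_to_rcons[_ e]; rewrite /path_mult path_vertex_last.
by rewrite path_vertex_rcons //= -endpointE /pairing (edge_mult e).
Qed.

(** Each step contributes the difference of the images of [chi] at its ends. *)
Lemma path_telescope w p : paths_to D J w p ->
  \sum_(1 <= j < (size p).+1) path_mult D J chi w p j *: path_root p j
    = act (endpoint w p) chi - act w chi.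
Proof.
elim/last_ind: p => [|p q IH] pp; first by rewrite big_geq // subrr.
have [/IH pE /edgeP[_ _ _ xy _]] := (paths_to_rcons w p q).1 pp.
rewrite size_rcons big_nat_recr //= path_mult_last // path_root_last.
rewrite endpoint_rcons xy /hrefl addrAC -pE scaleNr; congr (_ - _).
by apply: eq_big_nat => j jp; rewrite path_mult_rcons // path_root_rcons.
Qed.

Lemma path_weight_rcons w p q : paths_to D J w (rcons p q) ->
  path_weight D J chi w (rcons p q) = path_weight D J chi w p *
    (cst (- co q.1 (act (endpoint w p) chi)) / phi (act q.2 chi - act w chi)).
Proof.
move=> pp; rewrite /path_weight size_rcons big_nat_recr //=; congr (_ * (_ / phi _)).
- apply: eq_big_nat => i /andP[i0 ip]; rewrite path_mult_rcons ?i0 //.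
  congr (_ / phi _); apply: eq_big_nat => j /andP[j0 ji].
  have jp : (0 < j <= size p)%N by rewrite j0 -ltnS (leq_trans ji).
  by rewrite path_mult_rcons // path_root_rcons.
- by rewrite path_mult_last.
by have := path_telescope pp; rewrite size_rcons endpoint_rcons.
Qed.

Definition coset_rep (mu : V) : W := xget 1%g [set x | minr x /\ act x chi = mu].

Lemma coset_repP z : minr (coset_rep (act z chi)) /\
  act (coset_rep (act z chi)) chi = act z chi.
Proof.
apply: (@xgetPex _ _ [set x | minr x /\ act x chi = act z chi]).
by have [x xm xz] := min_rep_exists z; exists x.
Qed.

Definition predecessors (y : W) : seq (V * W) :=
  [seq (b, coset_rep (hrefl b (act y chi))) | b <- fset_set (descents (act y chi))].

Lemma predecessorsP y q : minr y -> q \in predecessors y <-> edge D J q.2 q.1 y.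
Proof.
move=> ym; have fin := descents_finite y.
have rE b : Defs.roots D b -> hrefl b (act y chi) = act (root_refl D b * y)%g chi.
  by move=> rb; rewrite actM act_root_refl.
split=> [/mapP[b]|].
  rewrite in_fset_set // => /set_mem [bp b0] ->; apply/edgeP => /=.
  have := coset_repP (root_refl D b * y)%g; rewrite -rE; last exact: bp.1.
  by case.
case: q => b x /= /edgeP[xm _ bp xy b0]; apply/mapP; exists b.
  by rewrite in_fset_set //; apply/mem_set.
congr (_, _); have := coset_repP (root_refl D b * y)%g.
rewrite -rE; last exact: bp.1.
by move=> [cm cE]; apply: min_rep_unique => //; rewrite cE.
Qed.

(** Paths are extended at their starting point, away from [w], so the induction
    needs all functions [f] of the starting point at once. *)
Lemma path_enum w k : minr w -> exists l : seq (seq (V * W)),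
  [/\ uniq l, (forall p, p \in l <-> paths_to D J w p /\ size p = k) &
   forall f, \sum_(p <- l) path_weight D J chi w p * f (act (endpoint w p) chi)
     = iter k (descent_step cst phi (act w chi)) f (act w chi)].
Proof.
move=> wm; elim: k => [|k [l [ul lP lE]]].
  exists [:: [::]]; split=> // [p|f].
    rewrite inE; split=> [/eqP->|[_ /size0nil ->//]].
    by split=> //; exact: paths_to_nil.
  by rewrite big_seq1 /path_weight big_geq // mul1r.
exists [seq rcons p q | p <- l, q <- predecessors (endpoint w p)]; split.
- apply: allpairs_uniq_dep => // [p pl|[p q] [p' q'] _ _ /= /rcons_inj [-> ->] //].
  by rewrite map_inj_uniq ?fset_uniq // => b b' [].
- move=> p; split=> [/allpairsPdep[p' [q [/lP[p'p <-] qp ->]]]|].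
    rewrite size_rcons; split=> //; apply/paths_to_rcons; split=> //.
    by apply/predecessorsP => //; exact: paths_to_min p'p.
  case/lastP: p => [[]//|p q [/paths_to_rcons[pp e]]]; rewrite size_rcons => -[pk].
  apply/allpairsPdep; exists p, q; split=> //; first exact/lP.
  by apply/predecessorsP => //; exact: paths_to_min pp.
move=> f; rewrite big_allpairs_dep iterSr -lE.
apply: eq_big_seq => p /lP[pp pk]; have pm := paths_to_min wm pp.
rewrite /descent_step /descent_sum fsbig_finite; last exact: descents_finite.
rewrite mulr_sumr big_map /=; apply: eq_big_seq => b bd.
set q := (b, _); have e : edge D J q.2 q.1 (endpoint w p).
  by apply/predecessorsP => //; apply/mapP; exists b.
rewrite path_weight_rcons; last by apply/paths_to_rcons.
rewrite endpoint_rcons; have /edgeP[_ _ _ -> _] := e.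
by rewrite /= -!mulrA; congr (_ * (_ * _)); rewrite mulrC.
Qed.

Lemma path_sum w u k : minr w -> reduced C u -> word s u = w ->
  exists l : seq (seq (V * W)),
  [/\ uniq l, (forall p, p \in l <-> paths_to D J w p /\ size p = k) &
   \sum_(p <- l) path_weight D J chi w p = deletion_sum phi u k (fun=> 1)].
Proof.
move=> wm ru uw; have [l [ul lP lE]] := path_enum k wm; exists l; split=> //.
rewrite (deletion_sum_iter _ _ QSym_in_generic) ?uw -?lE.
  by apply: eq_bigr => p _; rewrite mulr1.
by move=> z zE; rewrite ru uw; have /min_repE := wm; apply; rewrite zE uw.
Qed.

Lemma path_sum_lt w u n : minr w -> reduced C u -> word s u = w ->
  exists l : seq (seq (V * W)),
  [/\ uniq l, (forall p, p \in l <-> paths_to D J w p /\ (size p < n)%N) &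
   \sum_(p <- l) path_weight D J chi w p = \sum_(k < n) deletion_sum phi u k (fun=> 1)].
Proof.
move=> wm ru uw; elim: n => [|n [l [ul lP lE]]].
  by exists [::]; split=> // [p|]; [split=> // -[]|rewrite big_nil big_ord0].
have [l' [ul' lP' lE']] := path_sum n wm ru uw; exists (l ++ l'); split.
- rewrite cat_uniq ul ul' andbT /=; apply/hasPn => p /lP'[_ pn].
  by apply/negP => /lP[_]; rewrite pn ltnn.
- move=> p; rewrite mem_cat ltnS leq_eqVlt; split.
    by move=> /orP[/lP[pp ->]|/lP'[pp ->]]; rewrite ?eqxx ?orbT.
  move=> [pp /orP[/eqP pn|pn]]; apply/orP; first by right; apply/lP'.
  by left; apply/lP.
by rewrite big_cat lE lE' big_ord_recr.
Qed.

End Paths.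
End Roots.

Theorem theorem5p1 (R : realType) (W : groupType) (r : nat)
    (C : coxeterSystem W r) (V : vectType R) (D : rootDatum C V)
    (Hroots : roots_split D) (Hinv : inversions_of_reduced D)
    (chi : V) (Hchi : dominant D chi)
    (J : {set 'I_r}) (HJ : stabilizer D chi = parabolic C J)
    (w : W) (Hw : min_rep C J w) :
  \sum_(p \in paths_to D J w) path_weight D J chi w p
    = \big[*%R/1]_(b \in inversions D w) (1 + 1 / QSym_in b)
  /\
  \sum_(p \in [set p | paths_to D J w p /\ size p = cox_length C w])
      path_weight D J chi w p
    = \big[*%R/1]_(b \in inversions D w) (1 / QSym_in b).
Proof.
have [u ru uw] := reduced_word C w.
have um : minimal_word D chi u.
  by move=> z zE; rewrite ru uw; have /(min_repE HJ) := Hw; apply; rewrite zE uw.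
have lw : cox_length C w = size u by rewrite ru uw.
have roots_uniq := word_roots_uniq Hinv um.
have invE : inversions D w = [set` word_roots D u].
  by rewrite -uw word_roots_inversions.
split.
  have [l [ul lP lE]] := path_sum_lt Hroots Hinv Hchi HJ (size u).+1 Hw ru uw.
  have -> : paths_to D J w = [set` l].
    apply/seteqP; split=> p /=; last by move=> /lP[].
    move=> pp; apply/lP; split=> //; rewrite ltnS -lw.
    by apply: leq_trans (paths_to_length pp); exact: leq_addl.
  by rewrite -fsbig_seq // lE deletion_sum_total // invE -fsbig_seq.
have [l [ul lP lE]] := path_sum Hroots Hinv Hchi HJ (size u) Hw ru uw.
have -> : [set p | paths_to D J w p /\ size p = cox_length C w] = [set` l].
  by apply/seteqP; split=> p /=; rewrite lP lw.
by rewrite -fsbig_seq // lE deletion_sum_top invE -fsbig_seq.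
Qed.
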